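(* Let $n\ge 3$. Then for all sufficiently large prime powers $q$, the $h$-polynomial $h_{\mathbb{B}_n(q)}$ is not interlaced by the Eulerian polynomial $A_n$; that is, there is $q_0$ such that for every prime power $q\ge q_0$ it is not the case that $h_{\mathbb{B}_n(q)}$ is real-rooted with $A_n\preceq h_{\mathbb{B}_n(q)}$.
   Context: $\mathbb{B}_n(q)$ is the lattice of all linear subspaces of an $n$-dimensional vector space over the finite field with $q$ elements, ordered by inclusion (a geometric lattice of rank $n$). For a finite poset $P$, the chain polynomial is $c_P=\sum_{k\ge 0}c_k(P)t^k$, with $c_k(P)$ the number of $k$-element chains of $P$; it is the $f$-polynomial of the order complex $\Delta(P)$ of all chains of $P$. If $\Delta(P)$ has dimension $d-1$ (i.e. the longest chains of $P$ have $d$ elements), the $h$-polynomial of $P$ is $h_P(t)=(1-t)^d c_P\left(\frac{t}{1-t}\right)$. The Eulerian polynomial is $A_n=\sum_{\sigma\in\mathfrak{S}_n}t^{\mathrm{des}(\sigma)}$, where $\mathfrak{S}_n$ is the symmetric group on $[n]$ and $\mathrm{des}(\sigma)=|\{i\in[n-1]:\sigma_i>\sigma_{i+1}\}|$. For real-rooted $f,g$ with positive leading coefficients and zeros $\cdots\le\alpha_2\le\alpha_1$ and $\cdots\le\beta_2\le\beta_1$ respectively (with multiplicity), $g\preceq f$ (''$f$ is interlaced by $g$'') means $\cdots\le\beta_2\le\alpha_2\le\beta_1\le\alpha_1$; in particular the degrees differ by at most one. *)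

(* Defs.v *)
From HB Require Import structures.
From mathcomp Require Import all_boot all_order all_fingroup all_algebra.
From mathcomp Require Import reals.
Set Implicit Arguments.
Unset Strict Implicit.
Unset Printing Implicit Defensive.
Import Order.TTheory GRing.Theory Num.Theory.
Import VectorInternalTheory.
Local Open Scope ring_scope.

(* An alias of {vspace V}, so that the order by inclusion is not imposed on   *)
(* {vspace V} itself.                                                         *)
Definition subspace_lattice (F : fieldType) (V : vectType F) : Type :=
  {vspace V}.

Fact subspace_display : Order.disp_t.
Proof. exact: Order.Disp tt tt. Qed.

Section SubspaceLattice.
Variables (F : finFieldType) (V : vectType F).
Local Notation L := (subspace_lattice V).

HB.instance Definition _ := Choice.copy L {vspace V}.
HB.instance Definition _ :=
  CanIsCountable (@vs2mxK F V : cancel (vs2mx : L -> _) (@mx2vs _ _ _)).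
HB.instance Definition _ : isFinite L :=
  CanIsFinite (@vs2mxK F V : cancel (vs2mx : L -> _) (@mx2vs _ _ _)).

Fact subspace_le_refl : reflexive (@subsetv F V : rel L).
Proof. by move=> U; apply: subvv. Qed.

Fact subspace_le_anti : antisymmetric (@subsetv F V : rel L).
Proof. by move=> U W UW; apply/eqP; rewrite eqEsubv. Qed.

Fact subspace_le_trans : transitive (@subsetv F V : rel L).
Proof. by move=> U W X; apply: subv_trans. Qed.

HB.instance Definition _ := Order.Le_isPOrder.Build subspace_display L
  subspace_le_refl subspace_le_anti subspace_le_trans.

Lemma subspace_leE (U W : L) : (U <= W)%O = ((U : {vspace V}) <= W)%VS.
Proof. by []. Qed.

End SubspaceLattice.

Section ChainPolynomial.
Variables (d : Order.disp_t) (P : finPOrderType d).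

Definition is_chain (C : {set P}) : bool :=
  [forall x in C, forall y in C, (x >=< y)%O].

Definition num_chains (k : nat) : nat :=
  #|[set C : {set P} | is_chain C & #|C| == k]|.

(* The largest size of a chain, i.e. 1 + the dimension of the order complex.  *)
Definition max_chain_size : nat := (\max_(C : {set P} | is_chain C) #|C|)%N.

Definition chain_poly (R : nzRingType) : {poly R} :=
  \poly_(k < #|P|.+1) (num_chains k)%:R.

(* (1 - t)^d c_P(t / (1 - t)), with denominators cleared term by term; see    *)
(* horner_h_poly below.                                                       *)
Definition h_poly (R : nzRingType) : {poly R} :=
  \sum_(k < max_chain_size.+1)
     (num_chains k)%:R *: ('X^k * (1 - 'X) ^+ (max_chain_size - k)).

Lemma num_chains_gt k : (max_chain_size < k)%N -> num_chains k = 0%N.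
Proof.
move=> ltdk; apply/eqP; rewrite cards_eq0; apply/eqP/setP => C.
rewrite !inE; apply/negP => /andP[chC /eqP Ck].
by move: ltdk; rewrite -Ck ltnNge (leq_bigmax_cond C chC).
Qed.

Lemma max_chain_size_le : (max_chain_size <= #|P|)%N.
Proof. by apply/bigmax_leqP => C _; apply: max_card. Qed.

Lemma horner_h_poly (K : fieldType) (t : K) : t != 1 ->
  (h_poly K).[t] =
    (1 - t) ^+ max_chain_size * (chain_poly K).[t / (1 - t)].
Proof.
move=> t1; have nz : 1 - t != 0 by rewrite subr_eq0 eq_sym.
rewrite /h_poly /chain_poly horner_poly horner_sum.
rewrite -(big_mkord xpredT
  (fun k => (num_chains k)%:R * (t / (1 - t)) ^+ k)).
rewrite (@big_cat_nat _ _ _ max_chain_size.+1) ?ltnS ?max_chain_size_le //=.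
rewrite [X in _ * (_ + X)]big1_seq ?addr0; last first.
  move=> k /andP[_]; rewrite mem_index_iota => /andP[ltdk _].
  by rewrite num_chains_gt // mul0r.
rewrite big_mkord mulr_sumr; apply: eq_bigr => k _.
rewrite hornerZ hornerM hornerXn horner_exp hornerD hornerN hornerX hornerC.
rewrite [RHS]mulrCA; congr (_ * _).
have ledk : (k <= max_chain_size)%N by rewrite -ltnS.
rewrite expr_div_n [RHS]mulrCA; congr (_ * _).
by apply: (canRL (mulfK _)); rewrite ?expf_neq0 // -exprD subnK.
Qed.

End ChainPolynomial.

(* Permutations of [n] are permutations of {0, ..., n - 1}; the bound i < n   *)
(* with i + 1 < n is enforced by the existence of j : 'I_n.                   *)
Definition des (n : nat) (s : 'S_n) : nat :=
  #|[set i : 'I_n | [exists j : 'I_n, (j == i.+1 :> nat) && (s j < s i)%N]]|.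

Definition eulerian_poly (R : nzRingType) (n : nat) : {poly R} :=
  \sum_(s : 'S_n) 'X^(des s).

Section Interlacing.
Variable R : realType.
Implicit Types (f g : {poly R}) (s a b : seq R).

(* s lists all zeros of f in R, with multiplicity and in weakly decreasing    *)
(* order, and f has no zeros outside R.                                       *)
Definition real_zeros f s : Prop :=
  sorted >=%R s /\ f = lead_coef f *: \prod_(x <- s) ('X - x%:P).

Definition real_rooted f : Prop := exists s, real_zeros f s.

(* ... <= b_1 <= a_1 <= b_0 <= a_0, each sequence being exhausted exactly     *)
(* where the alternation stops.                                               *)
Definition alternates b a : Prop :=
  (forall i, (i < size b)%N -> (i < size a)%N /\ b`_i <= a`_i) /\
  (forall i, (i.+1 < size a)%N -> (i < size b)%N /\ a`_i.+1 <= b`_i).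

(* g \preceq f: f is interlaced by g.                                         *)
Definition interlaces g f : Prop :=
  [/\ 0 < lead_coef g, 0 < lead_coef f &
      exists b a, [/\ real_zeros g b, real_zeros f a & alternates b a]].

End Interlacing.

(* Main.v *)
Require Import Defs.
From mathcomp Require Import all_boot all_order all_fingroup all_algebra.
From mathcomp Require Import reals.
Import Order.TTheory GRing.Theory Num.Theory.
Set Implicit Arguments.
Unset Strict Implicit.
Unset Printing Implicit Defensive.
Local Open Scope ring_scope.

(** As q grows, maximal flags of subspaces outnumber all other chains, so that
    h, divided by its leading coefficient, tends to t^(n-1) and all zeros of h
    tend to 0.  The zeros of A_n are negative and do not depend on q.
    Interlacing would place the second largest zero of h below the largest
    zero of A_n, hence keep it away from 0.

    To make this quantitative, put m = n - 1 and let N_k be the number of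
    k-chains of proper nonzero subspaces.  Both 0 and the whole space are
    comparable to everything, and removing such cone points does not change
    the h-polynomial [h_poly_bounded], so
      h = sum_(k <= m) N_k t^k (1 - t)^(m - k).
    A k-chain with k < m misses some dimension, and there are at least q ways
    to insert a subspace of that dimension [chain_extensions]; a double count
    gives q N_k <= (k + 1) N_(k+1).  Hence, for every fixed B and for
    q >= 2 n B, the weighted sum of the N_k B^(m - k) over k < m is less than
    N_m [proper_chains_dominated].  With such a domination, h has degree at
    least m [dominated_size], and has no zero t < 0 with 1 - t <= B (- t), that
    is, with |t| >= 1 / (B - 1) [dominated_no_root].

    On the other side A_n has nonnegative coefficients with sum n!, and the
    identity contributes the constant 1, so all its zeros are at most - 1 / n!
    [eulerian_root].  The choice B = n! + 1 makes the two bounds collide.  The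
    assumption n >= 3 provides the second zero of h. *)

(** * Chains inside a subset of a finite poset *)

Section Chains.
Variables (d : Order.disp_t) (P : finPOrderType d).
Implicit Types (C D S : {set P}) (x z : P).

Definition chains_in S : {set {set P}} :=
  [set C | is_chain C & C \subset S].

Definition num_chains_in S k : nat := #|[set C in chains_in S | #|C| == k]|.

Lemma is_chainP {C} :
  reflect {in C &, forall x y, (x >=< y)%O} (is_chain C).
Proof.
apply: (iffP forall_inP) => [H x y Cx Cy | H x Cx].
  exact: (forall_inP (H x Cx)).
by apply/forall_inP => y Cy; apply: H.
Qed.

Lemma is_chain_sub C D : C \subset D -> is_chain D -> is_chain C.
Proof.
move=> /subsetP sCD /is_chainP chD; apply/is_chainP => x y Cx Cy.
by apply: chD; apply: sCD.
Qed.

Lemma is_chainU1 x C :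
  is_chain C -> {in C, forall y, (x >=< y)%O} -> is_chain (x |: C).
Proof.
move=> /is_chainP chC cmpx; apply/is_chainP => y z.
rewrite !inE => /predU1P[-> | Cy] /predU1P[-> | Cz].
- exact: comparablexx.
- exact: cmpx.
- by rewrite comparable_sym; apply: cmpx.
- exact: chC.
Qed.

Lemma sum_chains_by_size (M : nmodType) S m (f : nat -> M) :
    {in chains_in S, forall C, (#|C| <= m)%N} ->
  \sum_(C in chains_in S) f #|C|
    = \sum_(k < m.+1) f k *+ num_chains_in S k.
Proof.
move=> lem; rewrite (partition_big (fun C => inord #|C| : 'I_m.+1) xpredT) //=.
apply: eq_bigr => k _; rewrite /num_chains_in -sumr_const.
have eqk C : C \in chains_in S -> (inord #|C| == k) = (#|C| == k).
  by move=> /lem leC; rewrite -val_eqE /= inordK.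
apply: eq_big => [C | C /andP[SC]].
  by rewrite [RHS]inE; apply: andb_id2l => /eqk.
by rewrite eqk // => /eqP ->.
Qed.

(** The cone argument: a chain C avoiding z is paired with z |: C, and the two
    terms add up by t^c (1-t)^(m+1-c) + t^(c+1) (1-t)^(m-c) = t^c (1-t)^(m-c).
    The bound on the sizes makes the truncated subtractions in the exponents
    true ones. *)
Lemma sum_chains_cone (R : nzRingType) S z m :
    z \in S -> (forall x, (z >=< x)%O) ->
    {in chains_in (S :\ z), forall C, (#|C| <= m)%N} ->
  \sum_(C in chains_in S) ('X^#|C| * (1 - 'X) ^+ (m.+1 - #|C|) : {poly R})
    = \sum_(C in chains_in (S :\ z)) 'X^#|C| * (1 - 'X) ^+ (m - #|C|).
Proof.
move=> Sz cmpz lem.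
have inD C : (C \in chains_in (S :\ z)) = (C \in chains_in S) && (z \notin C).
  by rewrite !inE subsetD1 andbA.
rewrite (bigID (fun C => z \in C)) /=.
(* The chains through z are the sets z |: C, for C a chain avoiding z. *)
rewrite (reindex_onto (fun C => z |: C) (fun C => C :\ z)) /=; last first.
  by move=> C /andP[_ /setD1K].
rewrite (eq_bigl (fun C => C \in chains_in (S :\ z))); last first.
  move=> C /=; rewrite inD setU11 andbT; have [zC | zNC] := boolP (z \in C).
    rewrite andbF; apply/negP => /andP[_ /eqP eC].
    by move: zC; rewrite -eC !inE eqxx.
  rewrite setU1K // eqxx !andbT !inE subUset sub1set Sz /=; congr (_ && _).
  apply/idP/idP => [|chC]; first exact/is_chain_sub/subsetUr.
  by apply: is_chainU1 => // y _; apply: cmpz.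
rewrite [X in _ + X](eq_bigl (fun C => C \in chains_in (S :\ z))) => [|C];
  last exact/esym/inD.
rewrite -big_split /=; apply: eq_bigr => C DC.
have zNC : z \notin C by move: DC; rewrite inD => /andP[].
rewrite cardsU1 zNC add1n subSS subSn ?lem //.
rewrite [(1 - _) ^+ _.+1]exprS exprSr -mulrA -mulrDr; congr (_ * _).
by rewrite -mulrDl addrC subrK mul1r.
Qed.

(** Double counting of the pairs (C, x |: C): a chain of size k.+1 arises from
    at most k.+1 chains, one for each of its elements. *)
Lemma num_chains_in_extend S q k :
    (forall C, C \in chains_in S -> #|C| = k ->
       (q <= #|[set x | x \notin C & x |: C \in chains_in S]|)%N) ->
  (q * num_chains_in S k <= k.+1 * num_chains_in S k.+1)%N.
Proof.
move=> ext; rewrite mulnC [leqRHS]mulnC /num_chains_in -!sum_nat_const.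
set K := [set C in chains_in S | #|C| == k].
set K' := [set C in chains_in S | #|C| == k.+1].
apply: (@leq_trans (\sum_(C in K)
    \sum_(x | (x \notin C) && (x |: C \in chains_in S)) 1)).
  apply: leq_sum => C; rewrite inE => /andP[SC /eqP Ck].
  by apply: leq_trans (ext C SC Ck) _; rewrite sum1dep_card.
rewrite (exchange_big_dep xpredT) //=.
apply: (@leq_trans (\sum_x \sum_(D in K' | x \in D) 1)); last first.
  rewrite (exchange_big_dep (mem K')) /=; last by move=> x D _ /andP[].
  apply: leq_sum => D KD.
  rewrite (eq_bigl (fun x => x \in D)) => [|x]; last first.
    by rewrite KD.
  by rewrite sum1_card; move: KD; rewrite inE => /andP[_ /eqP->].
(* For fixed x, the map C |-> x |: C is injective on the sets avoiding x. *)
apply: leq_sum => x _; rewrite !sum1dep_card.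
set E := [set _ | _]; rewrite -(@card_in_imset _ _ (fun C => x |: C) E).
  apply/subset_leq_card/subsetP => _ /imsetP[C + ->].
  rewrite !inE => /andP[/andP[_ /eqP Ck] /andP[xC /andP[-> ->]]].
  by rewrite cardsU1 xC Ck add1n !eqxx.
move=> C D; rewrite !inE => /and3P[_ xC _] /and3P[_ xD _] eCD.
by rewrite -(setU1K xC) eCD setU1K.
Qed.

(** Removing two cone points z0 and z1 (in practice, the bottom and the top)
    expresses h through the chains of the remaining poset.  The length of that
    poset must be known to be exactly m, since h_poly is homogenised with the
    largest chain size, which is then m.+2. *)
Lemma h_poly_bounded (R : nzRingType) (z0 z1 : P) m :
    z0 != z1 -> (forall x, (z0 >=< x)%O) -> (forall x, (z1 >=< x)%O) ->
    let S := setT :\ z0 :\ z1 in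
    {in chains_in S, forall C, (#|C| <= m)%N} -> (0 < num_chains_in S m)%N ->
  h_poly P R
    = \sum_(k < m.+1) ('X^k * (1 - 'X) ^+ (m - k)) *+ num_chains_in S k.
Proof.
move=> nz01 cmp0 cmp1 S lem.
rewrite card_gt0 => /set0Pn[C0]; rewrite inE => /andP[SC0 /eqP C0m].
have chain_le (T : {set P}) z j :
    {in chains_in (T :\ z), forall C, (#|C| <= j)%N} ->
    {in chains_in T, forall C, (#|C| <= j.+1)%N}.
  move=> leT C; rewrite inE => /andP[chC sCT].
  have := leT (C :\ z); rewrite inE setSD // (is_chain_sub (subD1set _ _) chC).
  move/(_ isT) => leC; rewrite (cardsD1 z).
  by case: (_ \in _); rewrite ?ltnS // ltnW.
have lem1 := chain_le _ _ _ lem; have lem2 := chain_le _ _ _ lem1.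
have dim_max : max_chain_size P = m.+2.
  apply/eqP; rewrite eqn_leq; apply/andP; split.
    by apply/bigmax_leqP => C chC; apply: lem2; rewrite inE chC subsetT.
  move: SC0; rewrite inE => /andP[chC0]; rewrite subsetD1 => /andP[].
  rewrite subsetD1 => /andP[_ n0] n1.
  have chD : is_chain (z0 |: (z1 |: C0)) by do 2!apply: is_chainU1 => //.
  apply: leq_trans (leq_bigmax_cond _ chD).
  by rewrite !cardsU1 !inE negb_or nz01 n0 n1 C0m.
transitivity (\sum_(C in chains_in setT)
    ('X^#|C| * (1 - 'X) ^+ (m.+2 - #|C|) : {poly R})).
  rewrite (sum_chains_by_size (fun k => 'X^k * (1 - 'X) ^+ (m.+2 - k)) lem2).
  rewrite /h_poly dim_max; apply: eq_bigr => k _; rewrite scaler_nat.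
  congr (_ *+ _); apply: eq_card => C; rewrite !inE.
  by rewrite subsetT andbT.
rewrite (sum_chains_cone _ _ cmp0 lem1) ?inE //.
rewrite (sum_chains_cone _ _ cmp1 lem) ?inE 1?eq_sym ?nz01 //.
exact: (sum_chains_by_size (fun k => 'X^k * (1 - 'X) ^+ (m - k)) lem).
Qed.

End Chains.

(** * Polynomials dominated by their last term *)

(** The factor 2 makes the sum of all earlier weighted terms behave like a
    geometric series, so that no estimate of its length is needed. *)
Lemma sum_lt_last (N : nat -> nat) (B m : nat) :
    (0 < B)%N -> (0 < N 0)%N ->
    (forall k, (k < m)%N -> (2 * B * N k <= N k.+1)%N) ->
  (\sum_(k < m) N k * B ^ (m - k) < N m)%N.
Proof.
move=> B0 N0; elim: m => [|m IH] H; first by rewrite big_ord0.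
have {}IH := IH (fun k lt => H k (ltnW lt)).
apply: leq_trans (H m (ltnSn m)).
rewrite big_ord_recr /= subSnn expn1.
rewrite (eq_bigr (fun k : 'I_m => B * (N k * B ^ (m - k)))%N) => [|k _].
  rewrite -big_distrr /= [(N m * B)%N]mulnC -mulnDr -mulnA mulnCA.
  by rewrite mul2n -addnn ltn_pmul2l // ltn_add2r.
by rewrite subSn 1?ltnW // expnS mulnCA.
Qed.

Section DominatedPoly.
Variables (R : realFieldType) (N : nat -> nat) (B m : nat).
Hypothesis dom : (\sum_(k < m) N k * B ^ (m - k) < N m)%N.

Let h : {poly R} :=
  \sum_(k < m.+1) ('X^k * (1 - 'X) ^+ (m - k)) *+ N k.

(** The k-th summand contributes N k, up to sign, to the coefficient of
    'X^m, and N m exceeds the sum of the others. *)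
Lemma dominated_size : (0 < B)%N -> (m < size h)%N.
Proof.
move=> B0; rewrite ltnNge; apply/negP => le_h.
have : h`_m = 0 by rewrite nth_default.
have coefm j : (j <= m)%N ->
    ('X^j * (1 - 'X) ^+ (m - j) : {poly R})`_m = (-1) ^+ (m - j).
  move=> lejm; rewrite coefXnM ltnNge lejm /=.
  have -> : 1 - 'X = -1 *: ('X - 1%:P) :> {poly R} by rewrite scaleN1r opprB.
  have := monic_exp (m - j) (monicXsubC (1 : R)).
  rewrite monicE lead_coefE size_exp_XsubC /= exprZn coefZ => /eqP ->.
  by rewrite mulr1.
rewrite coef_sum big_ord_recr /= coefMn coefm // subnn expr0.
move/eqP; rewrite addrC addr_eq0 => /eqP eN.
have : (N m)%:R <= \sum_(k < m) (N k * B ^ (m - k))%:R :> R.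
  rewrite -[leLHS]ger0_norm // eN normrN.
  apply: le_trans (ler_norm_sum _ _ _) _; apply: ler_sum => k _.
  rewrite coefMn coefm 1?ltnW // normrMn normrX normrN1 expr1n ler_nat.
  by rewrite leq_pmulr // expn_gt0 B0.
by rewrite -natr_sum ler_nat leqNgt dom.
Qed.

(** With s = - t, the k-th summand is at most N k * s^k * (1 + s)^(m - k), hence
    at most s^m * N k * B^(m - k): the last summand, of absolute value
    s^m * N m, cannot be cancelled by the others. *)
Lemma dominated_no_root (t : R) :
  t < 0 -> 1 - t <= B%:R * - t -> h.[t] != 0.
Proof.
move=> t0 tB; apply/negP; rewrite horner_sum big_ord_recr /= hornerMn.
rewrite !hornerE subnn expr0 mulr1 addrC addr_eq0 => /eqP eN.
have nt0 : 0 < - t by rewrite oppr_gt0.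
have : (N m)%:R * (- t) ^+ m
         <= (\sum_(k < m) (N k * B ^ (m - k))%N)%:R * (- t) ^+ m.
  have -> : (N m)%:R * (- t) ^+ m = `|t ^+ m *+ N m|.
    by rewrite normrMn normrX ltr0_norm // mulr_natl.
  rewrite eN normrN natr_sum mulr_suml.
  apply: le_trans (ler_norm_sum _ _ _) _; apply: ler_sum => k _.
  have lekm := ltnW (ltn_ord k).
  rewrite hornerMn normrMn !hornerE normrM !normrX (ltr0_norm t0).
  rewrite ger0_norm; last by rewrite subr_ge0 (le_trans (ltW t0)).
  rewrite natrM natrX -mulrA -[leLHS]mulr_natl ler_wpM2l //.
  have -> : B%:R ^+ (m - k) * (- t) ^+ m
              = (- t) ^+ k * (B%:R * - t) ^+ (m - k) :> R.
    by rewrite exprMn mulrCA -exprD subnKC.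
  rewrite ler_wpM2l ?exprn_ge0 ?(ltW nt0) // lerXn2r ?nnegrE //.
  - by rewrite subr_ge0 (le_trans (ltW t0)).
  - by rewrite mulr_ge0 // ltW.
by rewrite ler_pM2r ?exprn_gt0 // ler_nat leqNgt dom.
Qed.

End DominatedPoly.

(** * Zeros of the Eulerian polynomials *)

(** The identity permutation has no descent and contributes 1.  For x >= 0 all
    terms are nonnegative, so there is no zero; for -1 < x < 0 each of the
    other terms is at least x, so that 1 + n! x <= 0 at a zero. *)
Lemma eulerian_root (R : realFieldType) n (x : R) :
  root (eulerian_poly R n) x -> x < 0 /\ 1 <= n`!%:R * - x.
Proof.
have des1 : des (1%g : 'S_n) = 0%N.
  apply/eqP; rewrite cards_eq0 -subset0; apply/subsetP => i.
  rewrite !inE => /existsP[j]; rewrite !perm1 => /andP[/eqP ->].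
  by rewrite ltnNge leqnSn.
move/rootP; rewrite horner_sum (bigD1 1%g) //= des1 hornerE => e0.
have x0 : x < 0.
  rewrite ltNge; apply/negP => x0; move/eqP: e0; apply/negP.
  rewrite gt_eqF // ltr_wpDr // sumr_ge0 // => s _.
  by rewrite hornerXn exprn_ge0.
split=> //; have [le1|lt1] := leP 1 (- x).
  apply: le_trans le1 _; rewrite ler_peMl ?oppr_ge0 ?(ltW x0) //.
  by rewrite ler1n fact_gt0.
have cardS : #|'S_n| = n`! by rewrite card_Sn.
have nx0 : 0 <= - x by rewrite oppr_ge0 ltW.
have le_sum : x *+ n`! <= \sum_(s : 'S_n | s != 1%g) ('X^(des s)).[x].
  rewrite -cardS -sumr_const (bigD1 (1%g : 'S_n)) //=.
  apply: (@le_trans _ _ (\sum_(s : 'S_n | s != 1%g) x)).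
    by rewrite gerDr ltW.
  apply: ler_sum => s _; rewrite hornerXn.
  have [-> | des_gt0] := posnP (des s).
    by rewrite expr0 (le_trans (ltW x0)).
  rewrite -[leLHS]opprK lerNl; apply: le_trans (ler_norm _) _.
  rewrite normrN normrX ltr0_norm // -[leRHS]expr1.
  by rewrite ler_wiXn2l // ltW.
rewrite mulrN mulr_natl lerNr; apply: le_trans le_sum _.
by rewrite -subr_ge0 -opprD e0 oppr0.
Qed.

(** * Chains of subspaces *)

Section Subspaces.
Variables (F : finFieldType) (V : vectType F).
Implicit Types (U W H : {vspace V}) (v : V).
Local Notation L := (subspace_lattice V).
Local Notation n := (\dim {:V}).

Lemma dim_add_line W v : v \notin W -> \dim (W + <[v]>) = (\dim W).+1.
Proof.
move=> Wv; have v0 : v != 0 by apply: contraNneq Wv => ->; apply: mem0v.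
apply/eqP; rewrite eqn_leq; apply/andP; split.
  by have := dimv_add_leqif W <[v]>; rewrite dim_vline v0 addn1 => -[].
rewrite ltn_neqAle dimvS ?addvSl // andbT.
apply: contraNneq Wv => eqd.
have /eqP -> : W == (W + <[v]>)%VS by rewrite eqEdim addvSl -eqd leqnn.
by apply: (subvP (addvSr _ _)); apply: memv_line.
Qed.

Lemma vspace_between W H k : (W <= H)%VS -> (\dim W <= k <= \dim H)%N ->
  exists2 U : {vspace V}, (W <= U <= H)%VS & \dim U = k.
Proof.
move=> sWH; elim: k => [|k IH] /andP[leWk lekH].
  by exists W; rewrite ?subvv // ; apply/eqP; rewrite -leqn0.
move: leWk; rewrite leq_eqVlt => /predU1P[eqW | ltWk].
  by exists W; rewrite ?subvv.
have [|U /andP[sWU sUH] dimU] := IH; first by rewrite -ltnS ltWk ltnW.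
have /subvPn[v Hv Uv] : ~~ (H <= U)%VS.
  by apply/negP => /dimvS; rewrite dimU leqNgt lekH.
exists (U + <[v]>)%VS; last by rewrite dim_add_line ?dimU.
by rewrite (subv_trans sWU (addvSl _ _)) subv_add sUH.
Qed.

(** Choose W' of dimension d - 1 between W and H, and u, v in H independent
    modulo W': the subspaces W' + <[u + a *: v]>, for a in F, are distinct. *)
Lemma card_vspace_between W H d : (W <= H)%VS -> (\dim W < d < \dim H)%N ->
  (#|F| <= #|[set U : L | (W <= (U : {vspace V}) <= H)%VS
                          & \dim (U : {vspace V}) == d]|)%N.
Proof.
case: d => // d sWH /andP[ltWd ltdH].
have [|W' /andP[sWW' sW'H] dimW'] := @vspace_between W H d sWH.
  by rewrite -ltnS ltWd ltnW // ltnW.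
have /subvPn[u Hu Wu] : ~~ (H <= W')%VS.
  by apply/negP => /dimvS; rewrite dimW' leqNgt ltnW.
have dimX := dim_add_line Wu.
have /subvPn[v Hv Xv] : ~~ (H <= W' + <[u]>)%VS.
  by apply/negP => /dimvS; rewrite dimX dimW' leqNgt ltdH.
have dimY := dim_add_line Xv.
pose f (a : F) : L := (W' + <[u + a *: v]>)%VS.
have memf a : u + a *: v \in (f a : {vspace V}).
  by apply: (subvP (addvSr _ _)); apply: memv_line.
have Wuav a : u + a *: v \notin W'.
  apply/negP => Wa; have [a0 | a0] := eqVneq a 0.
    by move: Wa; rewrite a0 scale0r addr0 (negPf Wu).
  case/negP: Xv; have := rpredZeq (W' + <[u]>)%VS a v.
  rewrite (negPf a0) /= => <-.
  rewrite -[_ *: _](addrK u) [_ + u]addrC rpredB //.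
    by apply: (subvP (addvSl _ _)).
  by apply: (subvP (addvSr _ _)); apply: memv_line.
have injf : injective f.
  move=> a b fab; apply/eqP/negPn/negP => nab.
  have fv : v \in (f a : {vspace V}).
    have := rpredZeq (f a : {vspace V}) (a - b) v.
    rewrite subr_eq0 (negPf nab) /= => <-.
    have -> : (a - b) *: v = (u + a *: v) - (u + b *: v).
      by rewrite scalerBl opprD addrACA subrr add0r.
    by rewrite rpredB // fab.
  have fu : u \in (f a : {vspace V}).
    by rewrite -[u](addrK (a *: v)) rpredB // rpredZ.
  (* Now f a contains W', u and v, which is one dimension too many. *)
  have : (W' + <[u]> + <[v]> <= (f a : {vspace V}))%VS.
    by rewrite !subv_add addvSl -!memvE fu fv.
  by move/dimvS; rewrite dimY dimX dim_add_line // ltnn.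
rewrite -(card_codom injf); apply/subset_leq_card/subsetP => _ /codomP[a ->].
rewrite inE dim_add_line // dimW' eqxx andbT (subv_trans sWW' (addvSl _ _)).
by rewrite subv_add sW'H -memvE rpredD // rpredZ.
Qed.

Lemma comparable_subspace (x y : L) :
  (x >=< y)%O = ((x : {vspace V}) <= y)%VS || ((y : {vspace V}) <= x)%VS.
Proof. by []. Qed.

Lemma comparable_dim_le (x y : L) : (x >=< y)%O ->
  (\dim (x : {vspace V}) <= \dim (y : {vspace V}))%N ->
  ((x : {vspace V}) <= y)%VS.
Proof.
rewrite comparable_subspace => /orP[//|syx] le_dim.
have /eqP -> : (y : {vspace V}) == x by rewrite eqEdim syx.
exact: subvv.
Qed.

Lemma comparable_dim_inj (x y : L) : (x >=< y)%O ->
  \dim (x : {vspace V}) = \dim (y : {vspace V}) -> x = y.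
Proof.
move=> cxy exy; have sxy := comparable_dim_le cxy; apply/eqP.
by rewrite -[_ == _]/((x : {vspace V}) == y) eqEdim sxy exy leqnn.
Qed.

Definition proper_subspaces : {set L} :=
  setT :\ (0%VS : L) :\ ({:V}%VS : L).

Lemma in_proper_subspaces (x : L) :
  (x \in proper_subspaces) = (0 < \dim (x : {vspace V}) < n)%N.
Proof.
rewrite !inE andbT andbC lt0n dimv_eq0 ltn_neqAle dimvS ?subvf // andbT.
congr (_ && ~~ _).
rewrite -[LHS]/((x : {vspace V}) == {:V}%VS) eqEdim eqn_leq subvf.
by rewrite (dimvS (subvf x)).
Qed.

Lemma uniq_chain_dims (C : {set L}) : is_chain C ->
  uniq [seq \dim (x : {vspace V}) | x : L in C].
Proof.
move=> /is_chainP chC; apply/dinjectiveP => x y Cx Cy.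
exact/comparable_dim_inj/chC.
Qed.

Lemma chain_size_le (C : {set L}) :
  C \in chains_in proper_subspaces -> (#|C| <= n.-1)%N.
Proof.
rewrite inE => /andP[chC /subsetP sCS].
rewrite -[n.-1](size_iota 1) cardE.
rewrite -(size_map (fun x : L => \dim (x : {vspace V}))).
apply: uniq_leq_size (uniq_chain_dims chC) _ => _ /imageP[x + ->].
rewrite mem_iota add1n => /sCS; rewrite in_proper_subspaces.
by case/andP=> x0 xn; rewrite x0 prednK // (ltn_trans x0).
Qed.

(** The dimensions along the chain are distinct and too few to exhaust
    1, ..., dim V - 1.  A missing dimension d can be filled by any subspace of
    dimension d between the last member below it and the first one above it,
    where 0 and V serve when the chain has none. *)
Lemma chain_extensions (C : {set L}) :
    C \in chains_in proper_subspaces -> (#|C| < n.-1)%N ->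
  (#|F| <= #|[set x | x \notin C & x |: C \in chains_in proper_subspaces]|)%N.
Proof.
rewrite inE => /andP[/[dup] chC /is_chainP cmpC /subsetP sCS] ltCn.
have [/allP all_dims | /allPn[d]] := boolP (all
    (mem [seq \dim (x : {vspace V}) | x : L in C]) (iota 1 n.-1)).
  have := uniq_leq_size (iota_uniq _ _) all_dims.
  by rewrite size_map size_iota -cardE leqNgt ltCn.
rewrite mem_iota add1n => /andP[d0 +] dC.
rewrite prednK => [dn|]; last by case: (n) ltCn.
have {}dC x : x \in C -> \dim (x : {vspace V}) != d.
  move=> Cx; apply: contra dC => /eqP <-.
  exact: (image_f (fun x : L => \dim (x : {vspace V}))).
pose belowP (x : L) := (x \in (0%VS : L) |: C) && (\dim (x : {vspace V}) < d)%N.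
pose aboveP (x : L) :=
  (x \in ({:V}%VS : L) |: C) && (d < \dim (x : {vspace V}))%N.
have below0 : belowP (0%VS : L) by rewrite /belowP setU11 dimv0.
have aboveT : aboveP ({:V}%VS : L) by rewrite /aboveP setU11.
have [W /andP[CW ltWd] maxW] :=
  arg_maxnP (fun x : L => \dim (x : {vspace V})) below0.
have [H /andP[CH ltdH] minH] :=
  arg_minnP (fun x : L => \dim (x : {vspace V})) aboveT.
have cmpW x : x \in C -> (x >=< W)%O.
  move=> Cx; move: CW; rewrite !inE => /predU1P[-> | CW]; last exact: cmpC.
  by rewrite comparable_subspace sub0v orbT.
have cmpH x : x \in C -> (x >=< H)%O.
  move=> Cx; move: CH; rewrite !inE => /predU1P[-> | CH]; last exact: cmpC.
  by rewrite comparable_subspace subvf.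
have sWH : ((W : {vspace V}) <= H)%VS.
  apply: comparable_dim_le (ltnW (ltn_trans ltWd ltdH)).
  move: CW; rewrite !inE => /predU1P[-> | /cmpH //].
  by rewrite comparable_subspace sub0v.
have ltWdH : (\dim (W : {vspace V}) < d < \dim (H : {vspace V}))%N.
  by rewrite ltWd.
apply: leq_trans (card_vspace_between sWH ltWdH) _.
apply/subset_leq_card/subsetP => U.
rewrite !inE => /andP[/andP[sWU sUH] /eqP dU].
apply/and3P; split.
- by apply: contraL isT => /dC; rewrite dU eqxx.
- apply: is_chainU1 => // y Cy; rewrite comparable_subspace.
  have := dC y Cy; rewrite neq_ltn => /orP[lt | gt].
    have leW : ((y : {vspace V}) <= W)%VS.
      apply: comparable_dim_le (cmpW y Cy) (maxW y _).
      by rewrite /belowP !inE Cy orbT.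
    by rewrite (subv_trans leW sWU) orbT.
  have leH : ((H : {vspace V}) <= y)%VS.
    apply: comparable_dim_le; first by rewrite comparable_sym cmpH.
    by apply: minH; rewrite /aboveP !inE Cy orbT.
  by rewrite (subv_trans sUH leH).
- rewrite subUset sub1set in_proper_subspaces dU d0 dn.
  exact/subsetP.
Qed.

Lemma num_proper_chains_growth B k :
    (2 * n * B <= #|F|)%N -> (k < n.-1)%N ->
  (2 * B * num_chains_in proper_subspaces k
     <= num_chains_in proper_subspaces k.+1)%N.
Proof.
move=> leB ltk; have n0 : (0 < n)%N by case: (n) ltk.
set N := num_chains_in _.
have grow : (#|F| * N k <= k.+1 * N k.+1)%N.
  apply: num_chains_in_extend => C SC Ck.
  by apply: chain_extensions; rewrite ?Ck.
rewrite -(leq_pmul2l n0); apply: (@leq_trans (#|F| * N k)%N).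
  by rewrite mulnA mulnCA mulnA leq_mul2r leB orbT.
apply: leq_trans grow _; rewrite leq_mul2r; apply/orP; right.
by rewrite (leq_trans ltk) ?leq_pred.
Qed.

Lemma proper_chains_dominated B : (0 < B)%N -> (2 * n * B <= #|F|)%N ->
  (\sum_(k < n.-1) num_chains_in proper_subspaces k * B ^ (n.-1 - k)
     < num_chains_in proper_subspaces n.-1)%N.
Proof.
move=> B0 leB; apply: sum_lt_last => // [|k ltk]; last first.
  exact: num_proper_chains_growth.
rewrite card_gt0; apply/set0Pn; exists set0; rewrite !inE cards0 sub0set eqxx.
by rewrite !andbT; apply/is_chainP => x y; rewrite inE.
Qed.

Lemma h_poly_subspaces (R : nzRingType) :
    (0 < n)%N -> (0 < num_chains_in proper_subspaces n.-1)%N ->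
  h_poly L R = \sum_(k < n.-1.+1)
    ('X^k * (1 - 'X) ^+ (n.-1 - k)) *+ num_chains_in proper_subspaces k.
Proof.
move=> n0 N0; apply: h_poly_bounded chain_size_le N0.
- rewrite -[_ == _]/((0 : {vspace V})%VS == {:V}%VS) eq_sym -dimv_eq0.
  by rewrite -lt0n.
- by move=> x; rewrite comparable_subspace sub0v.
- by move=> x; rewrite comparable_subspace subvf orbT.
Qed.

End Subspaces.

(** * The second zero of h *)

Lemma root_real_zeros (R : realType) (f : {poly R}) (s : seq R) i :
  real_zeros f s -> (i < size s)%N -> root f s`_i.
Proof.
case=> _ -> lti; apply/rootP; rewrite hornerZ (rootP _) ?mulr0 //.
by rewrite root_prod_XsubC mem_nth.
Qed.

Lemma size_real_zeros (R : realType) (f : {poly R}) (s : seq R) :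
  lead_coef f != 0 -> real_zeros f s -> size f = (size s).+1.
Proof. by move=> f0 [_ ->]; rewrite size_scale // size_prod_XsubC. Qed.

Theorem proposition7p1 (R : realType) (n : nat) (hn : (3 <= n)%N) :
  exists q0 : nat, forall (p e : nat) (F : finFieldType) (V : vectType F),
    prime p -> (0 < e)%N -> (q0 <= p ^ e)%N ->
    #|F| = (p ^ e)%N -> \dim {:V} = n ->
    ~ (real_rooted (h_poly (subspace_lattice V) R) /\
       interlaces (eulerian_poly R n) (h_poly (subspace_lattice V) R)).
Proof.
(* The number n!.+1 is the B for which 1 - t <= B (- t) means - t >= 1 / n!. *)
exists (2 * n * n`!.+1)%N => p e F V _ _ + cardF dimV.
rewrite -cardF -[in (2 * n)%N]dimV => leq0.
case=> _ [_ lead_h [b [a [zb za [_ alt_ab]]]]].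
have dom := proper_chains_dominated (ltn0Sn _) leq0.
have n0 : (0 < \dim {:V})%N by rewrite dimV (leq_trans _ hn).
have hE := h_poly_subspaces R n0 (leq_ltn_trans (leq0n _) dom).
have lt1a : (1 < size a)%N.
  have := dominated_size R dom (ltn0Sn _).
  rewrite -hE (size_real_zeros _ za) ?gt_eqF // ltnS; apply: leq_trans.
  by rewrite dimV -ltnS prednK // (leq_trans _ hn).
(* Position 1 of a, counted from 0, holds the second largest zero of h; it lies
   below the largest zero of A_n. *)
have [b0 le_ab] := alt_ab 0%N lt1a.
have [blt0 ble] := eulerian_root (root_real_zeros zb b0).
have alt0 := le_lt_trans le_ab blt0.
have := root_real_zeros za lt1a; rewrite /root hE; apply/negP.
apply: dominated_no_root dom _ alt0 _.
rewrite -natr1 mulrDl mul1r lerD2r (le_trans ble) // ler_wpM2l //.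
by rewrite lerN2.
Qed.
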